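(* For any integer $N\geq 1$ and any numbers $0<\gamma,\delta <1$, there exists a small number $\varepsilon=\varepsilon(N,\gamma,\delta)>0$ such that the following holds: whenever $\mu$ is a complex finite Borel measure on $\mathbb{T}$ with total variation norm $\leq 1$ and (i) $\sum_{|n|\leq N} |\widehat{\mu}(n)|^2 \geq \gamma$, (ii) $|\widehat{\mu}(n)| \leq \varepsilon$ for all $n\in\mathbb{Z}$ with $|n|>N$, except possibly for $n$ in a $3$-sparse set, then $\sup_{\zeta\in \mathbb{T}} \operatorname{dist}(\zeta,\operatorname{supp}(\mu))\leq \delta$.
   Context: $\mathbb{T}$ is the unit circle and $\widehat{\mu}(n)=\int_{\mathbb{T}}\zeta^{-n}\,d\mu(\zeta)$, $n\in\mathbb{Z}$. For $N>1$, a subset of integers $\Lambda\subset\mathbb{Z}$ is said to be $N$-sparse if $\inf\{|n|/|m| : n,m\in\Lambda,\ |n|>|m|\}\geq N$. By convention the empty set is $N$-sparse for any $N>1$. *)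

(* Defs.v *)
From HB Require Import structures.
From mathcomp Require Import all_boot all_order all_algebra.
From mathcomp Require Import complex.
From mathcomp Require Import all_classical all_reals all_analysis.

Set Implicit Arguments.
Unset Strict Implicit.
Unset Printing Implicit Defensive.

Import Order.TTheory GRing.Theory Num.Theory.
Import numFieldNormedType.Exports.

Local Open Scope classical_set_scope.
Local Open Scope ring_scope.
Local Open Scope complex_scope.

(* The norm `|z| of z : R[i] is itself an element of R[i]; normc z : R is the
   modulus as a real number. *)
Notation normc := Normc.normc.

HB.instance Definition _ (R : realType) :=
  NormedModule.copy R[i] R[i]^o.

Definition circle (R : realType) : Type :=
  set_type [set z : R[i] | normc z = 1].

Section circle_instances.
Context (R : realType).

Lemma circle1_subproof : (1 : R[i]) \in [set z : R[i] | normc z = 1].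
Proof. by rewrite inE /=; exact: Normc.normc1. Qed.

Definition circle1 : circle R := exist _ 1 circle1_subproof.

HB.instance Definition _ := Uniform.copy (circle R)
  (set_type [set z : R[i] | normc z = 1]).
HB.instance Definition _ := isPointed.Build (circle R) circle1.

End circle_instances.

Definition borel_circle (R : realType) :=
  g_sigma_algebraType (@open (circle R)).

(* Complex measures on a measurable space T are the R[i]-valued charges
   mu : {charge set T -> \bar R[i]}: mu is finite and countably additive on
   measurable sets, so fine (mu A) : R[i] is the value of mu on such an A. *)

Lemma normc_ge_Im (R : realType) (z : R[i]) : `|complex.Im z|%:C <= `|z|.
Proof.
by case: z => a b; simpc; rewrite -sqrtr_sqr ler_wsqrtr // lerDr sqr_ge0.
Qed.

Section additive_part.
Context (R : realType) (d : measure_display) (T : measurableType d).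
Variables (mu : {charge set T -> \bar R[i]}) (p : R[i] -> R).
Hypothesis pB : {morph p : x y / x - y}.
Hypothesis le_p : forall z : R[i], `|p z|%:C <= `|z|.

Lemma additive_part_cvg (F : (set T)^nat) :
  (forall i, measurable (F i)) -> trivIset setT F ->
  (fun n => \sum_(0 <= i < n) p (fine (mu (F i)))) @ \oo -->
    p (fine (mu (\bigcup_n F n))).
Proof.
have p0 : p 0 = 0 by rewrite -(subrr 0) pB subrr.
have pN : {morph p : x / - x} by move=> z; rewrite -sub0r pB p0 sub0r.
have pD : {morph p : x y / x + y}.
  by move=> x y; rewrite -[y in LHS]opprK pB pN opprK.
move=> mF tF; have mU : measurable (\bigcup_n F n) by exact: bigcup_measurable.
have := @charge_semi_sigma_additive _ _ _ mu F mF tF mU.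
rewrite -(fineK (fin_num_measure mu _ mU)) => /fine_cvg.
set l := fine _ => /cvgrPdist_lt cvg.
apply/cvgrPdist_lt => e e0.
have eC0 : 0 < e%:C :> R[i] by rewrite ltcR.
near=> n.
have : `|l - fine (\sum_(0 <= i < n) mu (F i))%E| < e%:C by near: n; exact: cvg.
rewrite -ltcR; apply: le_lt_trans.
rewrite -(big_morph p pD p0) -pB (le_trans (le_p _))//.
rewrite sum_fine// => i _; exact: fin_num_measure.
Unshelve. all: by end_near. Qed.

End additive_part.

Section re_im_charge.
Context (R : realType) (d : measure_display) (T : measurableType d).
Variable mu : {charge set T -> \bar R[i]}.

Definition re_charge (A : set T) : \bar R := (complex.Re (fine (mu A)))%:E.

Definition im_charge (A : set T) : \bar R := (complex.Im (fine (mu A)))%:E.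

Let re_charge0 : re_charge set0 = 0%E.
Proof. by rewrite /re_charge charge0. Qed.

Let re_charge_fin A : measurable A -> re_charge A \is a fin_num.
Proof. by []. Qed.

Let re_charge_additive : semi_sigma_additive re_charge.
Proof.
move=> F mF tF _; under eq_fun do rewrite sumEFin.
apply: cvg_EFin; first by near=> n.
exact: (additive_part_cvg (p := @complex.Re R)
  (@raddfB _ _ (@complex.Re R : Rcomplex R -> R)) (@normc_ge_Re R)).
Unshelve. all: by end_near. Qed.

HB.instance Definition _ := isCharge.Build _ _ _ re_charge
  re_charge0 re_charge_fin re_charge_additive.

Let im_charge0 : im_charge set0 = 0%E.
Proof. by rewrite /im_charge charge0. Qed.

Let im_charge_fin A : measurable A -> im_charge A \is a fin_num.
Proof. by []. Qed.

Let im_charge_additive : semi_sigma_additive im_charge.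
Proof.
move=> F mF tF _; under eq_fun do rewrite sumEFin.
apply: cvg_EFin; first by near=> n.
exact: (additive_part_cvg (p := @complex.Im R)
  (@raddfB _ _ (@complex.Im R : Rcomplex R -> R)) (@normc_ge_Im R)).
Unshelve. all: by end_near. Qed.

HB.instance Definition _ := isCharge.Build _ _ _ im_charge
  im_charge0 im_charge_fin im_charge_additive.

End re_im_charge.

Section integral.
Context (R : realType) (d : measure_display) (T : measurableType d).

(* Integral of a real function against a signed measure: the difference of the
   integrals against the two parts of its Jordan decomposition, which do not
   depend on the Hahn decomposition that is picked. *)
Definition charge_integral (nu : {charge set T -> \bar R}) (f : T -> R) : R :=
  let hahn := projT2 (cid (projT2 (cid (Hahn_decomposition nu)))) in
  \int[jordan_pos hahn]_x f x - \int[jordan_neg hahn]_x f x.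

(* (Re f + i Im f) d(Re mu + i Im mu), expanded *)
Definition complex_integral (mu : {charge set T -> \bar R[i]})
    (f : T -> R[i]) : R[i] :=
  let re g := charge_integral (re_charge mu) g in
  let im g := charge_integral (im_charge mu) g in
  let Ref x := complex.Re (f x) in
  let Imf x := complex.Im (f x) in
  (re Ref - im Imf) +i* (re Imf + im Ref).

(* |mu|(E), the supremum over the countable measurable partitions of E *)
Definition measure_variation (mu : {charge set T -> \bar R[i]}) (E : set T) :
    \bar R :=
  ereal_sup [set (\sum_(i <oo) (normc (fine (mu (F i))))%:E)%E |
    F in [set F : (set T)^nat |
      [/\ forall i, measurable (F i), trivIset setT F & \bigcup_i F i = E]]].

End integral.

Section circle_measure.
Context (R : realType).
Implicit Type mu : {charge set (borel_circle R) -> \bar R[i]}.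

Definition fourier_coef mu (n : int) : R[i] :=
  complex_integral mu (fun z : borel_circle R => set_val z ^ (- n)).

(* the smallest closed set whose complement is |mu|-null *)
Definition measure_support mu : set (circle R) :=
  \bigcap_(F in [set F : set (circle R) |
    closed F /\ measure_variation mu (~` F) = 0%E]) F.

(* +oo when A is empty *)
Definition circle_dist (z : circle R) (A : set (circle R)) : \bar R :=
  ereal_inf [set (normc (set_val z - set_val w))%:E | w in A].

End circle_measure.

(* The quotient is taken in \bar R, where x / 0 = +oo for x > 0, so that m = 0
   imposes no constraint; the infimum of the empty set is +oo. *)
Definition sparse (R : realType) (N : R) (L : set int) : Prop :=
  let ratio (n m : int) : \bar R := (`|n|%R%:~R%:E / `|m|%R%:~R%:E)%E in
  let ratios := [set ratio nm.1 nm.2 |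
    nm in [set nm : int * int | [/\ L nm.1, L nm.2 & `|nm.1| > `|nm.2|]]] in
  (N%:E <= ereal_inf ratios)%E.

(* Main.v *)
(* Let [zeta0] be a point of the circle at distance more than [delta] from the
   support. The trigonometric polynomial [P_K(u) = ((1 + u)^2 / (4 u))^K] has
   nonnegative coefficients [p(m) = 'C(2K, K + m) / 4^K] of total mass [1], and
   [|P_K(u)| <= rho^K], [rho < 1], when [|u - 1| >= delta / 2]. Integrating
   [P_K(z / zeta)] against [mu] shows that [sum_{|m| <= K} p(m) mu^(m) z^m] is
   [O(rho^K)] for [z] within [delta / 2] of [zeta0]. Dropping the frequencies
   where [|mu^(m)| <= eps] costs at most [eps] and leaves an exponential sum with
   only [n = O(N + log K)] terms. Sampling it along a progression [zeta0 w^j],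
   [0 <= j <= n], with [|w - 1|] of order [delta / K], and removing all
   frequencies but one by first order differences bounds each low coefficient by
   [(C K / delta)^n K 3^N (rho^K + eps)]. Since [K^(log K) rho^K] tends to [0],
   a large [K] followed by a small [eps] contradicts (i). *)

Require Import Defs.
From mathcomp Require Import all_boot all_order all_algebra.
From mathcomp Require Import complex.
From mathcomp Require Import all_classical all_reals all_analysis.
From mathcomp Require Import measurable_realfun ring lra zify.

Set Implicit Arguments.
Unset Strict Implicit.
Unset Printing Implicit Defensive.

Import Order.TTheory GRing.Theory Num.Theory.
Import numFieldNormedType.Exports.

Local Open Scope classical_set_scope.
Local Open Scope ring_scope.

(** * Exponential sums and binomial weights *)

Lemma exp_sum_coef_bound (C : numFieldType) (I : Type) (S : seq I)
    (u : C) (v b : I -> C) (c B kappa : C) :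
  0 <= kappa -> `|u| = 1 -> (forall s, `|v s| = 1) ->
  all (fun s => kappa <= `|u - v s|) S ->
  (forall i, (i <= size S)%N ->
     `|c * u ^+ i + \sum_(s <- S) b s * v s ^+ i| <= B) ->
  `|c| * kappa ^+ size S <= 2 ^+ size S * B.
Proof.
(* [h(i+1) - v_s h(i)] has no [v_s] term, at most doubles the bound and multiplies
   [c] by [u - v_s]. *)
move=> k0 u1 v1; elim: S b c B => [|s S IH] b c B /=.
  by move=> _ /(_ 0%N isT); rewrite big_nil addr0 !expr0 !mulr1 mul1r.
move=> /andP[ks kS] hB.
have := IH (fun t => b t * (v t - v s)) (c * (u - v s)) (2 * B) kS.
have step i : (i <= size S)%N -> `|c * (u - v s) * u ^+ i +
    \sum_(t <- S) b t * (v t - v s) * v t ^+ i| <= 2 * B.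
  move=> iS.
  have -> : c * (u - v s) * u ^+ i + \sum_(t <- S) b t * (v t - v s) * v t ^+ i
      = (c * u ^+ i.+1 + \sum_(t <- s :: S) b t * v t ^+ i.+1)
        - v s * (c * u ^+ i + \sum_(t <- s :: S) b t * v t ^+ i).
    rewrite !big_cons.
    have -> : \sum_(t <- S) b t * (v t - v s) * v t ^+ i =
        \sum_(t <- S) b t * v t ^+ i.+1 - v s * \sum_(t <- S) b t * v t ^+ i.
      rewrite mulr_sumr -sumrB; apply: eq_bigr => t _; rewrite exprS; ring.
    rewrite !exprS; ring.
  apply: (le_trans (ler_normB _ _)); rewrite normrM v1 mul1r mulr2n mulrDl !mul1r.
  by apply: lerD; apply: hB => //; rewrite leqW.
move=> /(_ step); rewrite normrM exprS [2 ^+ _.+1]exprS => h.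
apply: (@le_trans _ _ (`|c| * `|u - v s| * kappa ^+ size S)).
  by rewrite mulrA ler_wpM2r ?exprn_ge0 ?ler_wpM2l.
by apply: (le_trans h); rewrite mulrA [2 ^+ _ * 2]mulrC.
Qed.

(** * Distances between powers of a number of modulus one *)

Lemma norm_expB1_le (C : numFieldType) (w : C) (j : nat) :
  `|w| = 1 -> `|w ^+ j - 1| <= j%:R * `|w - 1|.
Proof.
move=> w1; elim: j => [|j IH]; first by rewrite subrr normr0 mul0r.
have -> : w ^+ j.+1 - 1 = w ^+ j * (w - 1) + (w ^+ j - 1) by rewrite exprSr; ring.
apply: (le_trans (ler_normD _ _)).
by rewrite normrM normrX w1 expr1n mul1r -natr1 mulrDl mul1r addrC lerD2r.
Qed.

Lemma normr_exprz1 (C : numFieldType) (w : C) (k : int) : `|w| = 1 -> `|w ^ k| = 1.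
Proof.
move=> w1; case: k => n; rewrite ?NegzE -?exprnN ?normfV normrX w1 expr1n ?invr1//.
Qed.

(** The cofactor of [w - 1] in [w ^+ j - 1] is the sum of the [w ^+ i], [i < j]. Each of these is
    within [1/2] of [1], so the sum has modulus at least [j / 2 >= 1/2]. *)
Lemma norm_expB1_ge (C : numClosedFieldType) (w : C) (j : nat) :
  `|w| = 1 -> (0 < j)%N -> j%:R * `|w - 1| <= 2^-1 -> 2^-1 * `|w - 1| <= `|w ^+ j - 1|.
Proof.
move=> w1 j0 jw.
rewrite subrX1 normrM mulrC ler_wpM2l//.
have -> : \sum_(i < j) w ^+ i = j%:R + \sum_(i < j) (w ^+ i - 1).
  by rewrite sumrB sumr_const card_ord addrC subrK.
apply: le_trans (lerB_normD _ _); rewrite normr_nat.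
have S : `|\sum_(i < j) (w ^+ i - 1)| <= j%:R * 2^-1.
  apply: (le_trans (ler_norm_sum _ _ _)).
  rewrite -[j in j%:R](card_ord j) mulr_natl -sumr_const; apply: ler_sum => i _.
  apply: (le_trans (norm_expB1_le i w1)); apply: le_trans jw.
  by rewrite ler_wpM2r// ler_nat ltnW.
have j1 : 1 <= j%:R :> C by rewrite ler1n.
apply: (@le_trans _ _ (j%:R - j%:R * 2^-1)); last by rewrite lerD2l lerN2.
have -> : j%:R - j%:R * 2^-1 = j%:R * 2^-1 :> C by field.
by rewrite -[leLHS]mul1r ler_wpM2r// invr_ge0.
Qed.

(** Factoring out the unimodular [w ^ s] leaves a power with positive exponent at most [M]. The
    separation is thus uniform over all pairs of distinct frequencies in a window of width [M]. *)
Lemma norm_unit_exprzB (C : numClosedFieldType) (w : C) (k s : int) (M : nat) :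
  `|w| = 1 -> k != s -> (`|k - s| <= M)%N -> M%:R * `|w - 1| <= 2^-1 ->
  2^-1 * `|w - 1| <= `|w ^ k - w ^ s|.
Proof.
move=> w1; wlog sk : k s / (s < k)%R.
  move=> H ks ksM hM; have [sk|sk|sk] := ltrgtP k s; last by rewrite sk eqxx in ks.
    by rewrite [leRHS]distrC; apply: (H _ _ sk _ _ hM); [rewrite eq_sym | rewrite distnC].
  exact: (H _ _ sk ks ksM hM).
move=> ks ksM hM; have w0 : w != 0 by rewrite -normr_eq0 w1 oner_eq0.
have [j kE] : exists j : nat, k = s + j%:Z by exists `|k - s|%N; lia.
have j0 : (0 < j)%N by lia.
have jM : (j <= M)%N by lia.
rewrite kE expfzDr// -{2}[w ^ s]mulr1 -mulrBr normrM.
rewrite normr_exprz1// mul1r; apply: norm_expB1_ge => //; apply: le_trans hM.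
by rewrite ler_wpM2r// ler_nat.
Qed.

(** * Size of the binomial coefficients and of the binomial kernel *)

Lemma central_bin_ge (K : nat) : (0 < K)%N -> (4 ^ K <= 2 * K * 'C(2 * K, K))%N.
Proof.
elim: K => // -[|K] IH _; first by [].
have {}IH := IH isT; set k := K.+1 in IH *.
(* [h1] and [h2] combine to [(k+1) 'C(2k+2, k+1) = 2 (2k+1) 'C(2k, k)], so passing from [k] to [k+1]
   multiplies [2 k 'C(2k, k)] by [2 (2k+1) / k >= 4]. *)
have h1 : (k.+1 * 'C(2 * k.+1, k.+1) = (2 * k.+1) * 'C((2 * k).+1, k))%N.
  have -> : (2 * k.+1 = (2 * k).+2)%N by lia.
  by rewrite mul_bin_diag.
have h2 : (k.+1 * 'C((2 * k).+1, k) = (2 * k).+1 * 'C(2 * k, k))%N.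
  have := mul_bin_left (2 * k).+1 k; have := mul_bin_diag (2 * k).+1 k.
  rewrite (_ : ((2 * k).+1 - k = k.+1)%N); last lia.
  by move=> <- <-.
rewrite expnS; nia.
Qed.

(** Passing from [K + k] to [K + k + 1] multiplies the coefficient by [(K - k) / (K + k + 1)], which
    is at least [1/3] while [2 (k + 1) <= K]. *)
Lemma bin_shift_ge (K k : nat) : (2 * k <= K)%N ->
  ('C(2 * K, K) <= 3 ^ k * 'C(2 * K, K + k))%N.
Proof.
elim: k => [|k IH] kK; first by rewrite addn0 mul1n.
have {}IH : ('C(2 * K, K) <= 3 ^ k * 'C(2 * K, K + k))%N by apply: IH; lia.
apply: (leq_trans IH); rewrite expnS addnS (mulnC 3) -mulnA leq_mul2l; apply/orP; right.
have := mul_bin_left (2 * K) (K + k); nia.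
Qed.

(** After division by [4 ^ K] this says that the kernel gives each frequency of the window a weight
    at least [1 / (2 K 3^N)]. Negative [k] reduce to positive ones by symmetry of the binomial
    coefficients. *)
Lemma bin_window_ge (K N : nat) (k : int) : (0 < K)%N -> (2 * N <= K)%N ->
  (`|k| <= N)%N -> (4 ^ K <= 2 * K * 3 ^ N * 'C(2 * K, `|(K%:Z + k)%R|))%N.
Proof.
move=> K0 NK kN.
have -> : 'C(2 * K, `|(K%:Z + k)%R|) = 'C(2 * K, K + `|k|)%N.
  case: (lerP 0 k) => k0; first by congr ('C(_, _)); lia.
  rewrite -[in RHS]bin_sub; last lia.
  by congr ('C(_, _)); lia.
apply: (leq_trans (central_bin_ge K0)); rewrite -(mulnA (2 * K)) leq_mul2l; apply/orP; right.
apply: (leq_trans (bin_shift_ge (k := `|k|%N) _)); first lia.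
by rewrite leq_mul2r leq_exp2l// kN orbT.
Qed.

Lemma binomial_kernelE (C : fieldType) (z : C) (K : nat) : z != 0 ->
  \sum_(i < (2 * K).+1) 'C(2 * K, i)%:R * z ^ (i%:Z - K%:Z) = ((1 + z) ^+ 2 / z) ^+ K.
Proof.
move=> z0; rewrite expr_div_n -exprM exprDn mulr_suml; apply: eq_bigr => i _.
by rewrite expr1n mul1r expfzDr// -exprnN -exprnP -(mulr_natl (z ^+ i)) mulrA.
Qed.

(** On the unit circle [|1 + z|^2 = 4 - |1 - z|^2], by the parallelogram identity. *)
Lemma norm_binomial_kernel (C : numClosedFieldType) (z r : C) (K : nat) :
  `|z| = 1 -> 0 <= r -> r <= `|1 - z| -> 
  `|((1 + z) ^+ 2 / z) ^+ K| <= 4 ^+ K * (1 - r ^+ 2 / 4) ^+ K.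
Proof.
move=> z1 r0 rz; rewrite -exprMn normrX normrM normrX normfV z1 invr1 mulr1.
have -> : `|1 + z| ^+ 2 = 4 - `|1 - z| ^+ 2.
  have zz : z * z^* = 1 by rewrite -normCK z1 expr1n.
  rewrite !normCK rmorphB rmorphD rmorph1; apply/eqP; rewrite -subr_eq0.
  have -> : (1 + z) * (1 + z^*) - (4 - (1 - z) * (1 - z^*)) = 2 * (z * z^*) - 2 :> C by ring.
  by rewrite zz mulr1 subrr.
have hr : r ^+ 2 <= `|1 - z| ^+ 2 by rewrite lerXn2r// nnegrE ?normr_ge0.
have z2 : `|1 - z| ^+ 2 <= 4.
  rewrite (_ : 4 = 2 ^+ 2); last by ring.
  rewrite lerXn2r ?nnegrE ?normr_ge0//.
  by apply: (le_trans (ler_normB _ _)); rewrite normr1 z1.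
rewrite lerXn2r ?nnegrE ?subr_ge0//.
  by rewrite mulrBr mulr1 mulrC divfK ?pnatr_eq0// subr_ge0 (le_trans hr).
by rewrite mulrBr mulr1 [4 * _]mulrC divfK ?pnatr_eq0// lerD2l lerN2.
Qed.

Lemma exists_cube_le_exp2 (l a : nat) : exists L, (l <= L)%N /\ (a * (L + 1) ^ 3 <= 2 ^ L)%N.
Proof.
have h m : (m < 2 ^ m)%N by exact: ltn_expl.
(* With [L = 4 m], [2^L] is the fourth power of [2^m >= m + 1]. Three of these factors absorb
   [(L + 1)^3 <= 64 (m + 1)^3], and the last one absorbs [64 a]. *)
exists (4 * (64 * a + l))%N; set m := (64 * a + l)%N; split; first by rewrite /m; lia.
apply: (@leq_trans ((m + 1) ^ 4)%N).
  apply: (@leq_trans (a * (4 * (m + 1)) ^ 3)%N).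
    by rewrite leq_mul2l leq_exp2r// orbC; apply/orP; left; lia.
  by rewrite expnMn (expnS _ 3) mulnA leq_mul2r; apply/orP; right; rewrite /m; lia.
by rewrite mulnC expnM leq_exp2r//; have := h m; lia.
Qed.

(** Index [i] carries the frequency [i - K] of the kernel [((1 + z)^2 / (4 z))^K]. *)
Definition binomial_weight (C : numFieldType) (K i : nat) : C :=
  'C(2 * K, i)%:R / 4 ^+ K.

Lemma binomial_weight_ge0 (C : numFieldType) K i : 0 <= binomial_weight C K i.
Proof. by rewrite divr_ge0 ?exprn_ge0. Qed.

Lemma sum_binomial_weight (C : numFieldType) K :
  \sum_(i < (2 * K).+1) binomial_weight C K i = 1.
Proof.
rewrite -mulr_suml -natr_sum.
have -> : (\sum_(i < (2 * K).+1) 'C(2 * K, i))%N = (4 ^ K)%N.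
  rewrite (_ : 4 = 2 ^ 2)%N// -expnM (_ : 2 = 1 + 1)%N//= expnDn.
  by apply: eq_bigr => i _; rewrite !exp1n !muln1.
by rewrite natrX divff// expf_neq0// pnatr_eq0.
Qed.

(** * Recovery of one low coefficient from samples of an exponential sum *)

Section exceptional_frequencies.
Variables (C : numClosedFieldType) (a : int -> C) (K N : nat) (S : seq int).
Variables (w z0 B eps : C).
Hypotheses (K0 : (0 < K)%N) (NK : (2 * N <= K)%N) (eps0 : 0 <= eps).
Hypotheses (w1 : `|w| = 1) (z01 : `|z0| = 1).
Hypothesis wK : (2 * K)%:R * `|w - 1| <= 2^-1.
Hypothesis aS : forall n, n \notin S -> (`|n| <= K)%N -> (N < `|n|)%N -> `|a n| <= eps.
Hypothesis SN : forall n : int, (`|n| <= N)%N -> n \in S.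
Hypothesis hB : forall j, (j <= size S)%N ->
  `|\sum_(i < (2 * K).+1)
      binomial_weight C K i * (z0 * w ^+ j) ^ (i%:Z - K%:Z) * a (i%:Z - K%:Z)| <= B.

(** [exp_sum_coef_bound] is applied to the nodes [w ^ n], with [n] in [S] distinct from [k]. The
    frequencies outside [S] cost at most [eps] because the weights sum to [1], and dividing by the
    weight of [k] produces the factor [2 K 3^N]. *)
Lemma low_coef_bound (k : int) : (`|k| <= N)%N ->
  `|a k| * (2^-1 * `|w - 1|) ^+ size S <=
  2 ^+ size S * (2 * K%:R * 3 ^+ N) * (B + eps).
Proof.
move=> kN.
pose f (i : 'I_(2 * K).+1) : int := i%:Z - K%:Z.
have f_inj : injective f by move=> i j /eqP; rewrite /f => h; apply/val_inj => /=; lia.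
have fK i : (`|f i| <= K)%N by have := ltn_ord i; rewrite /f; lia.
have kK : (`|(k + K%:Z)%R| < (2 * K).+1)%N by lia.
pose ik := Ordinal kK.
have fik : f ik = k by rewrite /f /=; lia.
pose T := [seq i <- index_enum 'I_(2 * K).+1 | (f i \in S) && (i != ik)].
pose p i := binomial_weight C K i.
have p0 i : 0 <= p i by exact: binomial_weight_ge0.
pose b i := p (nat_of_ord i) * a (f i) * z0 ^ f i.
have sT : (size T <= size S)%N.
  rewrite -(size_map f); apply: uniq_leq_size.
    by rewrite map_inj_uniq// filter_uniq// index_enum_uniq.
  by move=> n /seq.mapP[j]; rewrite mem_filter => /andP[/andP[h _] _] ->.
set kap := 2^-1 * `|w - 1|.
have kap0 : 0 <= kap by rewrite mulr_ge0.
have sep i : i != ik -> kap <= `|w ^ k - w ^ f i|.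
  move=> iik; apply: norm_unit_exprzB wK => //.
    by rewrite -fik; apply: contra iik => /eqP/f_inj ->.
  by have := fK i; have := fK ik; rewrite fik; lia.
(* This lets the exponent [size T] be raised to [size S] at the end. *)
have kap1 : kap <= 1.
  have : `|w - 1| <= 2 by rewrite (le_trans (ler_normB _ _))// w1 normr1.
  by rewrite /kap mulrC ler_pdivrMr// mul1r.
have key : `|b ik| * kap ^+ size T <= 2 ^+ size T * (B + eps).
  apply: (@exp_sum_coef_bound C _ T (w ^ k) (fun i => w ^ f i) b) => //.
  - exact: normr_exprz1.
  - by move=> i; exact: normr_exprz1.
  - by apply/allP => i; rewrite mem_filter => /andP[/andP[_ h] _]; exact: sep.
  move=> j jT.
  (* Since [b i] absorbs [z0 ^ f i], sampling at [z0 * w ^+ j] gives pure powers of the nodes. *)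
  have term i : b i * (w ^ f i) ^+ j =
      binomial_weight C K i * (z0 * w ^+ j) ^ (i%:Z - K%:Z) * a (i%:Z - K%:Z).
    rewrite /b /p -/(f i) expfzMl [w ^+ j]exprnP exprz_exp [j%:Z * _]mulrC -exprz_exp exprnP.
    ring.
  have := hB (leq_trans jT sT); under eq_bigr do rewrite -term.
  rewrite (bigD1 ik)//= (bigID (fun i => f i \in S))/= fik.
  set r := \sum_(i | (i != ik) && (f i \notin S)) _.
  rewrite big_filter.
  have -> : \sum_(i <- index_enum 'I_(2 * K).+1 | (f i \in S) && (i != ik)) b i * (w ^ f i) ^+ j
    = \sum_(i | (i != ik) && (f i \in S)) b i * (w ^ f i) ^+ j.
    by apply: eq_bigl => i; rewrite andbC.
  set q := \sum_(i | _) _ => hq.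
  (* [r], the part of the sum over frequencies outside [S], is the error of size [eps]. *)
  have -> : b ik * (w ^ k) ^+ j + q = (b ik * (w ^ k) ^+ j + (q + r)) - r by ring.
  apply: (le_trans (ler_normB _ _)); apply: lerD => //.
  apply: (le_trans (ler_norm_sum _ _ _)).
  apply: (@le_trans _ _ (\sum_(i < (2 * K).+1) p i * eps)).
    rewrite [leRHS](bigID (fun i => (i != ik) && (f i \notin S)))/= -[leLHS]addr0.
    apply: lerD; last by apply: sumr_ge0 => i _; rewrite mulr_ge0.
    apply: ler_sum => i /andP[_ fiS].
    rewrite normrM normrX normr_exprz1 ?normr_exprz1// expr1n mulr1 /b 2!normrM.
    rewrite normr_exprz1// mulr1 [`|p i|]ger0_norm//.
    rewrite ler_wpM2l//; apply: aS => //; rewrite ltnNge; apply: contra fiS; exact: SN.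
  by rewrite -mulr_suml sum_binomial_weight mul1r.
have B0 : 0 <= B by exact: le_trans (normr_ge0 _) (hB (leq0n _)).
have pk : 1 <= (2 * K%:R * 3 ^+ N) * p ik.
  rewrite mulrA ler_pdivlMr ?exprn_gt0// mul1r.
  have := bin_window_ge K0 NK kN.
  by rewrite -(ler_nat C) !natrM !natrX addrC.
have bk : `|a k| <= (2 * K%:R * 3 ^+ N) * `|b ik|.
  rewrite /b fik 2!normrM (normr_exprz1 _ z01) mulr1 [`|p _|]ger0_norm// mulrA.
  by rewrite -[leLHS]mul1r ler_wpM2r.
have D0 : 0 <= 2 * K%:R * 3 ^+ N :> C by rewrite !mulr_ge0 ?exprn_ge0.
apply: (@le_trans _ _ ((2 * K%:R * 3 ^+ N) * (`|b ik| * kap ^+ size T))).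
  rewrite mulrA; apply: ler_pM => //; first exact: exprn_ge0.
  by apply: ler_wiXn2l.
rewrite [X in _ <= X]mulrAC [X in _ <= X]mulrC ler_wpM2l//.
apply: (le_trans key); rewrite ler_wpM2r ?addr_ge0//.
by rewrite ler_eXn2l// ltr1n.
Qed.

End exceptional_frequencies.

(** * Comparison of growth rates that fixes the degree [K = 2 ^ L] *)

Lemma exponential_beats_power_log (R : realType) (delta rho alpha : R) (N : nat) :
  0 < delta -> 0 <= rho < 1 -> 0 < alpha -> exists L, (N + 2 <= L)%N /\
    (64 * 2 ^+ L / delta) ^+ (2 * N + 2 * L + 3) * (2 * 2 ^+ L * 3 ^+ N)
      * (8 * rho ^+ (2 ^ L)) < alpha.
Proof.
move=> d0 /andP[r0 r1] a0.
have pow2 (x : R) : exists D, x <= 2 ^+ D.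
  have [D xD] : exists D : nat, x < D%:R.
    exists (Num.truncn x).+1; exact: truncnS_gt.
  by exists D; rewrite (le_trans (ltW xD))// -natrX ler_nat ltnW// ltn_expl.
(* The constants are replaced by powers of two, [64 / delta <= 2^D], [2 / alpha <= 2^E] and
   [rho^(2^e) <= 1/2], so that only exponents remain to be compared. *)
have [D hD] := pow2 (64 / delta).
have [E hE] := pow2 (2 / alpha).
have [e re] : exists e, rho ^+ (2 ^ e) <= 2^-1.
  have /cvgrPdist_lt /(_ 2^-1) : (fun n => rho ^+ n) @ \oo --> (0 : R).
    by apply: cvg_expr; rewrite ger0_norm.
  rewrite invr_gt0 => /(_ ltac:(by []))[m _ /(_ m) /=]; rewrite leqnn => /(_ isT).
  rewrite sub0r normrN ger0_norm ?exprn_ge0// => rm.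
  exists m; apply: le_trans (ltW rm); apply: ler_wiXn2l => //; first exact: ltW.
  by rewrite ltnW// ltn_expl.
(* The total exponent of the growing factors is quadratic in [L] and at most [A (L + 1)^2]. The
   factor [2 ^ e] given to the next lemma pays for [rho^(2^L)] being bounded only by [2^-M] with
   [M = 2^(L - e)]. *)
pose A := ((D + 1) * (2 * N + 3) + 2 * N + 5 + E)%N.
have [L [lL hL]] := exists_cube_le_exp2 (N + 2 + e) (2 ^ e * A).
exists L; split; first lia.
have two0 n : 0 < 2 ^+ n :> R by exact: exprn_gt0.
have eL : (2 ^ L = 2 ^ e * 2 ^ (L - e))%N by rewrite -expnD subnKC//; lia.
have AL : (A * (L + 1) ^ 3 <= 2 ^ (L - e))%N.
  by move: hL; rewrite eL -mulnA leq_pmul2l// expn_gt0.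
set M := (2 ^ (L - e))%N in AL.
have rL : rho ^+ (2 ^ L) <= (2 ^+ M)^-1.
  by rewrite eL exprM -exprVn lerXn2r ?nnegrE ?exprn_ge0 ?invr_ge0.
have h1 : (64 * 2 ^+ L / delta) ^+ (2 * N + 2 * L + 3) <=
    2 ^+ ((D + L) * (2 * N + 2 * L + 3)).
  rewrite exprM lerXn2r ?nnegrE ?exprn_ge0//.
    by rewrite divr_ge0 ?(ltW d0)// mulr_ge0// exprn_ge0.
  by rewrite mulrAC exprD ler_wpM2r// ltW.
have h2 : 2 * 2 ^+ L * 3 ^+ N <= 2 ^+ (1 + L + 2 * N) :> R.
  have c0 : 0 <= 2 * 2 ^+ L :> R by rewrite mulr_ge0// ltW.
  by rewrite 2!exprD expr1 ler_wpM2l// exprM lerXn2r ?nnegrE// expr2; lra.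
have expo : ((D + L) * (2 * N + 2 * L + 3) + (1 + L + 2 * N) + 3 + E <= M)%N.
  apply: leq_trans AL; rewrite /A.
  apply: (@leq_trans (((D + 1) * (2 * N + 3) + 2 * N + 5 + E) * (L + 1) ^ 2)%N).
    rewrite expnS expn1; nia.
  by rewrite leq_mul2l leq_exp2l ?orbT//; lia.
(* As [2^E >= 2 / alpha], a product at most [1] here leaves a quantity at most [alpha / 2]. *)
have small : 2 ^+ E * ((64 * 2 ^+ L / delta) ^+ (2 * N + 2 * L + 3) * (2 * 2 ^+ L * 3 ^+ N)
      * (8 * rho ^+ (2 ^ L))) <= 1.
  apply: (@le_trans _ _ (2 ^+ E * (2 ^+ ((D + L) * (2 * N + 2 * L + 3)) * 2 ^+ (1 + L + 2 * N)
      * (2 ^+ 3 * (2 ^+ M)^-1)))).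
    rewrite ler_wpM2l ?(ltW (two0 _))//.
    have b0 : 0 <= 64 * 2 ^+ L / delta by rewrite divr_ge0 ?(ltW d0)// mulr_ge0// exprn_ge0.
    apply: ler_pM; rewrite ?mulr_ge0 ?exprn_ge0//.
      by apply: ler_pM; rewrite ?mulr_ge0 ?exprn_ge0.
    by apply: ler_pM; rewrite ?exprn_ge0// !exprS expr0; lra.
  rewrite !mulrA -!exprD ler_pdivrMr// mul1r -!exprSr ler_eXn2l ?ltr1n//; lia.
set X := _ * (8 * _) in small *.
have X0 : 0 <= X.
  by rewrite /X !mulr_ge0 ?exprn_ge0// divr_ge0 ?(ltW d0)// mulr_ge0// exprn_ge0.
have : 2 / alpha * X <= 1 by apply: le_trans small; rewrite ler_wpM2r.
by rewrite mulrAC ler_pdivrMr// mul1r; lra.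
Qed.

Local Open Scope complex_scope.

(** * Integration against complex measures *)

Section finite_measure_integral.
Context (R : realType) (d : measure_display) (T : measurableType d).
Variable m : {finite_measure set T -> \bar R}.

Lemma bounded_Rintegrable (f : T -> R) (M : R) (D : set T) : measurable D ->
  measurable_fun setT f -> (forall x, `|f x| <= M) -> m.-integrable D (EFin \o f).
Proof.
move=> mD mf fM; apply: measurable_bounded_integrable => //.
- by rewrite ltey_eq fin_num_measure.
- exact: measurable_funTS.
- by exists M; split => [|x Mx y _]; [exact: num_real | exact: le_trans (fM y) (ltW Mx)].
Qed.

(** The integral is split over [U] and its complement. On [U] the crude bound [M] is multiplied by
    measure zero; off [U] the bound [b] meets a mass at most [1]. *)
Lemma Rintegral_le_measure (f : T -> R) (M b : R) (U : set T) : measurable U ->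
  m U = 0%E -> (m setT <= 1)%E -> measurable_fun setT f ->
  (forall x, `|f x| <= M) -> 0 <= b -> (forall x, ~ U x -> `|f x| <= b) ->
  `|\int[m]_x f x| <= b.
Proof.
move=> mU U0 T1 mf fM b0 fb.
have mnf : measurable_fun setT (fun x => `|f x|) by exact: measurableT_comp.
have nfM x : `| `|f x| | <= M by rewrite normr_id.
have icst D c : measurable D -> m.-integrable D (EFin \o (cst c : T -> R)).
  by move=> mD; apply: (@bounded_Rintegrable _ `|c|).
apply: (le_trans (le_normr_Rintegral _ _)) => //.
  exact: bounded_Rintegrable fM.
rewrite -(setUv U) Rintegral_setU//; first last.
- exact/disj_setPRL.
- by rewrite setUv; exact: bounded_Rintegrable nfM.
- exact: measurableC.
rewrite [leRHS](_ : b = M * 0 + b); last by rewrite mulr0 add0r.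
have mC := measurableC mU.
apply: lerD.
  apply: (@le_trans _ _ (\int[m]_(x in U) cst M x)).
    by apply: le_Rintegral => //; [exact: bounded_Rintegrable nfM | exact: icst].
  by have -> : \int[m]_(x in U) cst M x = M * fine (m U); [exact: Rintegral_cst | rewrite U0].
apply: (@le_trans _ _ (\int[m]_(x in ~` U) cst b x)).
  apply: le_Rintegral => //; first exact: bounded_Rintegrable nfM.
  exact: icst.
have -> : \int[m]_(x in ~` U) cst b x = b * fine (m (~` U)) by exact: Rintegral_cst.
rewrite -[leRHS]mulr1 ler_wpM2l//.
rewrite -[leRHS]/(fine (1%E : \bar R)) fine_le ?fin_num_measure//.
by apply: le_trans T1; apply: le_measure => //; rewrite inE.
Qed.

End finite_measure_integral.

(** * Integrals against real charges *)

Section charge_integral_theory.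
Context (R : realType) (d : measure_display) (T : measurableType d).
Variable nu : {charge set T -> \bar R}.
Implicit Types f g : T -> R.

(** Such functions are integrable against both parts of any Jordan decomposition, which makes the
    integral linear on them. *)
Definition bounded_measurable f :=
  measurable_fun setT f /\ exists M, forall x, `|f x| <= M.

Lemma charge_integralD f g : bounded_measurable f -> bounded_measurable g ->
  charge_integral nu (fun x => f x + g x) =
  charge_integral nu f + charge_integral nu g.
Proof.
move=> [mf [M fM]] [mg [M' gM]]; rewrite /charge_integral !RintegralD//;
  try by [apply: bounded_Rintegrable fM | apply: bounded_Rintegrable gM].
ring.
Qed.

Lemma charge_integralZ f (c : R) : bounded_measurable f ->
  charge_integral nu (fun x => c * f x) = c * charge_integral nu f.
Proof.
move=> [mf [M fM]]; rewrite /charge_integral !RintegralZl ?mulrBr//;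
  exact: bounded_Rintegrable fM.
Qed.

(** Subsets are quantified over because [nu A = 0] alone allows cancellation inside [A]; in this
    form nullity passes to both Jordan parts. *)
Definition charge_null (A : set T) :=
  measurable A /\ forall B, measurable B -> B `<=` A -> nu B = 0%E.

(** Up to sign the Jordan parts are [nu] restricted to the Hahn sets [P] and [N], so each vanishes
    on every [F i] and has mass at most [1]. The two parts give the factor [2]. *)
Lemma charge_integral_le (F : (set T)^nat) f (b : R) :
  bounded_measurable f -> (forall i, charge_null (F i)) ->
  (forall B, measurable B -> (`|nu B| <= 1)%E) ->
  0 <= b -> (forall x, ~ (\bigcup_i F i) x -> `|f x| <= b) ->
  `|charge_integral nu f| <= 2 * b.
Proof.
move=> [mf [M fM]] F0 nu1 b0 fb.
pose hahn := projT2 (cid (projT2 (cid (Hahn_decomposition nu)))).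
rewrite -[charge_integral nu f]/(\int[jordan_pos hahn]_x f x - \int[jordan_neg hahn]_x f x).
have mF i : measurable (F i) by have [] := F0 i.
have mU : measurable (\bigcup_i F i) by exact: bigcup_measurable.
have null (m : {finite_measure set T -> \bar R}) :
    (forall i, m (F i) = 0%E) -> m (\bigcup_i F i) = 0%E.
  move=> m0; apply/eqP; rewrite -measure_le0.
  apply: (le_trans (measure_sigma_subadditive m mF mU (@subset_refl _ _))).
  by rewrite eseries0// => i _ _; exact: m0.
apply: (le_trans (ler_normB _ _)); rewrite mulr2n mulrDl !mul1r.
set P := projT1 (cid (Hahn_decomposition nu)) in hahn *.
set N := projT1 (cid (projT2 (cid (Hahn_decomposition nu)))) in hahn *.
have [mP mN] : measurable P /\ measurable N.
  by have [[? _] [? _] _ _] := hahn.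
have pE A : measurable A -> jordan_pos hahn A = nu (A `&` P).
  by move=> mA; rewrite jordan_posE cjordan_posE /crestr0 mem_set.
have nE A : measurable A -> jordan_neg hahn A = (- nu (A `&` N))%E.
  by move=> mA; rewrite jordan_negE cjordan_negE /crestr0 mem_set.
have eq_le (x y : \bar R) : x = y -> (x <= y)%E by move=> ->.
apply: lerD.
  apply: (Rintegral_le_measure mU _ _ mf fM b0 fb).
    apply: null => i; apply: (eq_trans (pE _ (mF i))); have [_ -> //] := F0 i.
    exact: measurableI.
  apply: (le_trans (eq_le _ _ (pE _ measurableT))).
  by rewrite setTI (le_trans (lee_abs _))// nu1.
apply: (Rintegral_le_measure mU _ _ mf fM b0 fb).
  apply: null => i; apply: (eq_trans (nE _ (mF i))); have [_ -> //] := F0 i; rewrite ?oppe0//.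
  exact: measurableI.
apply: (le_trans (eq_le _ _ (nE _ measurableT))).
by rewrite setTI (le_trans (lee_abs _))// abseN nu1.
Qed.

End charge_integral_theory.

(** * Complex integrals and total variation *)

Section complex_integral_theory.
Context (R : realType) (d : measure_display) (T : measurableType d).
Implicit Types (mu : {charge set T -> \bar R[i]}) (f g : T -> R[i]).
Local Notation Re := (@complex.Re R).
Local Notation Im := (@complex.Im R).

Lemma bounded_measurable_cst (c : R) : bounded_measurable (fun _ : T => c).
Proof. by split; [exact: measurable_cst | exists `|c|]. Qed.

Lemma bounded_measurableD (f g : T -> R) : bounded_measurable f ->
  bounded_measurable g -> bounded_measurable (fun x => f x + g x).
Proof.
move=> [mf [M fM]] [mg [M' gM]]; split; first exact: measurable_funD.
by exists (M + M') => x; rewrite (le_trans (ler_normD _ _))// lerD.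
Qed.

Lemma bounded_measurableM (f g : T -> R) : bounded_measurable f ->
  bounded_measurable g -> bounded_measurable (fun x => f x * g x).
Proof.
move=> [mf [M fM]] [mg [M' gM]]; split; first exact: measurable_funM.
by exists (M * M') => x; rewrite normrM ler_pM.
Qed.

Lemma bounded_measurableN (f : T -> R) : bounded_measurable f ->
  bounded_measurable (fun x => - f x).
Proof.
move=> [mf [M fM]]; split; first exact: measurableT_comp.
by exists M => x; rewrite normrN.
Qed.

Definition cbounded_measurable f :=
  bounded_measurable (Re \o f) /\ bounded_measurable (Im \o f).

Lemma cbounded_measurable_cst (c : R[i]) : cbounded_measurable (fun=> c).
Proof. by split; exact: bounded_measurable_cst. Qed.

Lemma cbounded_measurableD f g : cbounded_measurable f ->
  cbounded_measurable g -> cbounded_measurable (fun x => f x + g x).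
Proof.
move=> [rf jf] [rg jg]; split.
  have := bounded_measurableD rf rg; congr bounded_measurable.
  by apply/funext => x /=; case: (f x) => a b; case: (g x).
have := bounded_measurableD jf jg; congr bounded_measurable.
by apply/funext => x /=; case: (f x) => a b; case: (g x).
Qed.

Lemma cbounded_measurableM f g : cbounded_measurable f ->
  cbounded_measurable g -> cbounded_measurable (fun x => f x * g x).
Proof.
move=> [rf jf] [rg jg]; split.
  have := bounded_measurableD (bounded_measurableM rf rg)
     (bounded_measurableN (bounded_measurableM jf jg)); congr bounded_measurable.
  by apply/funext => x /=; case: (f x) => a b; case: (g x).
have := bounded_measurableD (bounded_measurableM rf jg)
   (bounded_measurableM jf rg); congr bounded_measurable.
by apply/funext => x /=; case: (f x) => a b; case: (g x).
Qed.

Lemma cbounded_measurableX f (n : nat) : cbounded_measurable f ->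
  cbounded_measurable (fun x => f x ^+ n).
Proof.
move=> mf; elim: n => [|n IH]; first exact: cbounded_measurable_cst.
under eq_fun do rewrite exprS; exact: cbounded_measurableM.
Qed.

Lemma complex_integralD mu f g : cbounded_measurable f ->
  cbounded_measurable g -> complex_integral mu (fun x => f x + g x) =
  complex_integral mu f + complex_integral mu g.
Proof.
move=> [rf jf] [rg jg]; rewrite /complex_integral.
have -> : (fun x => Re (f x + g x)) = (fun x => Re (f x) + Re (g x)).
  by apply/funext => x; case: (f x) => a b; case: (g x).
have -> : (fun x => Im (f x + g x)) = (fun x => Im (f x) + Im (g x)).
  by apply/funext => x; case: (f x) => a b; case: (g x).
rewrite !charge_integralD//; apply/eqP; rewrite eq_complex/=.
by apply/andP; split; apply/eqP; ring.
Qed.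

Lemma complex_integralZ mu f (c : R[i]) : cbounded_measurable f ->
  complex_integral mu (fun x => c * f x) = c * complex_integral mu f.
Proof.
case: c => a b; move=> [rf jf]; rewrite /complex_integral.
have Z c := bounded_measurableM (bounded_measurable_cst c) rf.
have Z' c := bounded_measurableM (bounded_measurable_cst c) jf.
have -> : (fun x => Re ((a +i* b) * f x)) = (fun x => a * Re (f x) + (- b) * Im (f x)).
  by apply/funext => x; case: (f x) => u v /=; rewrite mulNr.
have -> : (fun x => Im ((a +i* b) * f x)) = (fun x => a * Im (f x) + b * Re (f x)).
  by apply/funext => x; case: (f x).
rewrite !charge_integralD// ?charge_integralZ//; apply/eqP; rewrite eq_complex/=.
by apply/andP; split; apply/eqP; ring.
Qed.

Lemma complex_integral_sum mu (n : nat) (c : nat -> R[i]) (f : nat -> T -> R[i]) :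
  (forall i, cbounded_measurable (f i)) ->
  cbounded_measurable (fun x => \sum_(i < n) c i * f i x) /\
  complex_integral mu (fun x => \sum_(i < n) c i * f i x) =
  \sum_(i < n) c i * complex_integral mu (f i).
Proof.
move=> mf; have mcf i := cbounded_measurableM (cbounded_measurable_cst (c i)) (mf i).
elim: n => [|n [mS IH]].
  (* Written as [0 * 0], the empty sum has its integral computed by homogeneity. *)
  have -> : (fun x => \sum_(i < 0) c i * f i x) = (fun x : T => 0 * 0).
    by apply/funext => x; rewrite big_ord0 mulr0.
  rewrite big_ord0; split; first exact: cbounded_measurable_cst.
  by rewrite (complex_integralZ mu 0 (cbounded_measurable_cst 0)) mul0r.
have -> : (fun x => \sum_(i < n.+1) c i * f i x) =
          (fun x => \sum_(i < n) c i * f i x + c n * f n x).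
  by apply/funext => x; rewrite big_ord_recr.
split; first exact: cbounded_measurableD.
by rewrite complex_integralD// IH complex_integralZ// big_ord_recr.
Qed.

Lemma normc_ge0 (z : R[i]) : 0 <= normc z.
Proof. by rewrite -lecR; exact: (normr_ge0 z). Qed.

Lemma le_normcB (x y : R[i]) : normc (x - y) <= normc x + normc y.
Proof. by rewrite -lecR rmorphD; exact: (ler_normB x y). Qed.

Lemma normc_distC (x y : R[i]) : normc (x - y) = normc (y - x).
Proof. by apply: complexI; exact: (distrC x y). Qed.

Lemma normc_le_ReIm (z : R[i]) : normc z <= `|Re z| + `|Im z|.
Proof.
case: z => a b /=; rewrite -[leRHS]ger0_norm ?addr_ge0// -sqrtr_sqr ler_wsqrtr//.
by rewrite sqrrD !real_normK ?num_real// -addrA lerD2l lerDr pmulrn_lge0// mulr_ge0.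
Qed.

Lemma normRe_le (z : R[i]) : `|Re z| <= normc z.
Proof. by rewrite -lecR; exact: normc_ge_Re. Qed.

Lemma normIm_le (z : R[i]) : `|Im z| <= normc z.
Proof. by rewrite -lecR; exact: normc_ge_Im. Qed.

Definition complex_null mu (A : set T) :=
  measurable A /\ forall B, measurable B -> B `<=` A -> fine (mu B) = 0.

(** The expansion into real and imaginary parts has four real integrals, each at most [2 * b]. *)
Lemma complex_integral_le mu f (F : (set T)^nat) (b : R) :
  cbounded_measurable f -> (forall i, complex_null mu (F i)) ->
  (forall B, measurable B -> normc (fine (mu B)) <= 1) ->
  0 <= b -> (forall x, ~ (\bigcup_i F i) x -> normc (f x) <= b) ->
  normc (complex_integral mu f) <= 8 * b.
Proof.
move=> [rf jf] F0 mu1 b0 fb.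
have fR x : ~ (\bigcup_i F i) x -> `|Re (f x)| <= b.
  by move=> /fb; apply: le_trans; exact: normRe_le.
have fI x : ~ (\bigcup_i F i) x -> `|Im (f x)| <= b.
  by move=> /fb; apply: le_trans; exact: normIm_le.
have F0R i : charge_null (re_charge mu) (F i).
  have [mF Fi0] := F0 i; split => // B mB BF.
  by rewrite /= /re_charge Fi0.
have F0I i : charge_null (im_charge mu) (F i).
  have [mF Fi0] := F0 i; split => // B mB BF.
  by rewrite /= /im_charge Fi0.
have mu1R B : measurable B -> (`|re_charge mu B| <= 1)%E.
  by move=> mB; rewrite /re_charge lee_fin (le_trans (normRe_le _))// mu1.
have mu1I B : measurable B -> (`|im_charge mu B| <= 1)%E.
  by move=> mB; rewrite /im_charge lee_fin (le_trans (normIm_le _))// mu1.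
apply: (le_trans (normc_le_ReIm _)) => /=.
have -> : 8 * b = (2 * b + 2 * b) + (2 * b + 2 * b) by ring.
apply: lerD.
  apply: (le_trans (ler_normB _ _)); apply: lerD.
    exact: charge_integral_le rf F0R mu1R b0 fR.
  exact: charge_integral_le jf F0I mu1I b0 fI.
apply: (le_trans (ler_normD _ _)); apply: lerD.
  exact: charge_integral_le jf F0R mu1R b0 fI.
exact: charge_integral_le rf F0I mu1I b0 fR.
Qed.

(** The partition [B], [E] minus [B], then empty sets is admissible in the supremum, and its first
    term is already the left-hand side. *)
Lemma variation_ge_normc mu (E B : set T) : measurable E -> measurable B ->
  B `<=` E -> ((normc (fine (mu B)))%:E <= measure_variation mu E)%E.
Proof.
move=> mE mB BE.
pose F (i : nat) : set T := if i == 0%N then B else if i == 1%N then E `\` B else set0.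
have mF i : measurable (F i).
  by rewrite /F; case: ifP => // _; case: ifP => // _; exact: measurableD.
have tF : trivIset setT F.
  move=> [|[|i]] [|[|j]] _ _ //=; rewrite /F /=;
    by [case=> x [] ? // []|case=> x [[] ? ? //]|case=> x []].
have UF : \bigcup_i F i = E.
  apply/seteqP; split => [x [[|[|i]] _] //= | x Ex].
  - exact: BE.
  - by case.
  - have [Bx|nBx] := pselect (B x); first by exists 0%N.
    by exists 1%N.
apply: (le_trans _ (ereal_sup_ubound _)); last by exists F.
have := @nneseries_lim_ge R (fun i => (normc (fine (mu (F i))))%:E) xpredT 0%N 1%N.
rewrite big_nat1; apply.
by move=> n _ _; rewrite lee_fin normc_ge0.
Qed.

Lemma measure_variation_le1 mu B : measurable B ->
  (measure_variation mu setT <= 1)%E -> normc (fine (mu B)) <= 1.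
Proof.
move=> mB h; rewrite -lee_fin; apply: le_trans h.
exact: variation_ge_normc.
Qed.

Lemma measure_variation_null mu E : measurable E ->
  measure_variation mu E = 0%E -> complex_null mu E.
Proof.
move=> mE h; split => // B mB BE; have := variation_ge_normc mu mE mB BE.
rewrite h lee_fin => h0; apply: Normc.eq0_normc; apply/eqP.
by rewrite eq_le h0 normc_ge0.
Qed.

End complex_integral_theory.

(** * The circle and the support of a measure *)

Section circle_topology.
Context (R : realType).
Local Notation Re := (@complex.Re R).
Local Notation Im := (@complex.Im R).
Implicit Types (z w : circle R).

Definition circle_ball (c : R[i]) (r : R) : set (circle R) :=
  [set z | normc (c - set_val z) < r].

Lemma open_circle_ball c r : open (circle_ball c r).
Proof.
have [r0|r0] := ltP 0 r; last first.
  have -> : circle_ball c r = set0.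
    by apply/seteqP; split => // z /= /lt_le_trans /(_ r0); rewrite ltNge normc_ge0.
  exact: open0.
have rC : 0 < r%:C :> R[i] by rewrite ltcR.
exists (ball (c : R[i]) r%:C); first exact: ball_open.
by apply/seteqP; split => z; rewrite /ball/= /circle_ball/= -ltcR.
Qed.

Lemma open_circle_ball_subset (G : set (circle R)) z : open G -> G z ->
  exists2 e : R, 0 < e & circle_ball (set_val z) e `<=` G.
Proof.
move=> [A oA <-] Az.
have : nbhs (set_val z : R[i]) A by exact: open_nbhs_nbhs.
move=> /nbhs_ballP[e /= e0 eA].
(* Radii of balls in [R[i]] are themselves complex numbers; being positive forces [e] to be real. *)
have [Ie Re0] : Im e = 0 /\ 0 < Re e.
  by move: e0; rewrite ltcE /= => /andP[/eqP].
exists (Re e) => // w /= zw; apply: eA; rewrite /ball/=.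
have -> : e = (Re e)%:C by apply/eqP; rewrite eq_complex /= Ie !eqxx.
by rewrite -[ltLHS]/((normc (set_val z - set_val w))%:C) ltcR.
Qed.

Lemma exists_rational_near (z : R[i]) (e : R) : 0 < e ->
  exists q : rat * rat, normc (ratr q.1 +i* ratr q.2 - z) < e.
Proof.
move=> e0; case: z => a b.
have [q1 q1a] : exists q : rat, ratr q \in `]a, (a + e / 2)[.
  by apply: rat_in_itvoo; rewrite ltrDl divr_gt0.
have [q2 q2b] : exists q : rat, ratr q \in `]b, (b + e / 2)[.
  by apply: rat_in_itvoo; rewrite ltrDl divr_gt0.
exists (q1, q2); apply: (le_lt_trans (normc_le_ReIm _)) => /=.
move: q1a q2b; rewrite !in_itv/= => /andP[h1 h2] /andP[h3 h4].
by rewrite !gtr0_norm ?subr_gt0//; lra.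
Qed.

Lemma circle_open_measurable (A : set (circle R)) : open A ->
  measurable (A : set (borel_circle R)).
Proof. by move=> oA; exact: sub_sigma_algebra. Qed.

(** It suffices to treat preimages of rays []r, +oo[]. By the Lipschitz bound such a preimage is a
    union of balls of radius [p z - r], which is open even though the union is uncountable. *)
Lemma measurable_circle_lip (p : R[i] -> R) :
  (forall x y, `|p x - p y| <= normc (x - y)) ->
  measurable_fun setT (fun z : borel_circle R => p (set_val z)).
Proof.
move=> hp; have := @measurability _ _ (borel_circle R) _ setT
  (fun z : borel_circle R => p (set_val z)) _ (RGenOInfty.measurableE R).
apply.
move=> _ [_ [r ->] <-]; rewrite setTI; apply: circle_open_measurable.
have -> : (fun z : borel_circle R => p (set_val z)) @^-1` `]r, +oo[%classic =
  \bigcup_(z in [set z : circle R | r < p (set_val z)])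
     circle_ball (set_val z) (p (set_val z) - r).
  apply/seteqP; split => [z|z [w /= rw]].
    rewrite /= in_itv/= andbT => rz; exists z => //=.
    by rewrite /circle_ball/= subrr Normc.normc0 subr_gt0.
  rewrite /circle_ball /= => h; rewrite /= in_itv/= andbT.
  have := le_lt_trans (le_trans (ler_norm _) (hp _ _)) h; lra.
by apply: bigcup_open => z _; exact: open_circle_ball.
Qed.

Lemma normc_set_val z : normc (set_val z) = 1.
Proof. exact: (set_mem (valP z)). Qed.

Lemma cbounded_measurable_set_val :
  cbounded_measurable (fun z : borel_circle R => set_val z).
Proof.
split; split.
- apply: measurable_circle_lip => x y; apply: le_trans (normRe_le _).
  by case: x => a b; case: y.
- by exists 1 => z /=; apply: (le_trans (normRe_le _)); rewrite normc_set_val.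
- apply: measurable_circle_lip => x y; apply: le_trans (normIm_le _).
  by case: x => a b; case: y.
- by exists 1 => z /=; apply: (le_trans (normIm_le _)); rewrite normc_set_val.
Qed.

Lemma circle_invE z : (set_val z)^-1 = (set_val z)^*.
Proof.
have n1 : `|set_val z| = 1 by rewrite -[LHS]/((normc (set_val z))%:C) normc_set_val.
by rewrite invc_norm n1 expr1n invr1 mul1r.
Qed.

Lemma cbounded_measurable_exprz (n : int) :
  cbounded_measurable (fun z : borel_circle R => set_val z ^ n).
Proof.
(* On the circle the inverse is the conjugate, so its real and imaginary parts are those of [z] up
   to sign. *)
have mj : cbounded_measurable (fun z : borel_circle R => (set_val z)^-1).
  have [rz jz] := cbounded_measurable_set_val; split.
    move: rz; congr bounded_measurable.
    by apply/funext => z /=; rewrite circle_invE; case: (set_val z).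
  have := bounded_measurableN jz; congr bounded_measurable.
  by apply/funext => z /=; rewrite circle_invE; case: (set_val z).
case: n => n; first exact: cbounded_measurableX cbounded_measurable_set_val.
rewrite NegzE; under eq_fun do rewrite -exprnN -exprVn.
exact: cbounded_measurableX mj.
Qed.

Section support_complement.
Variable mu : {charge set (borel_circle R) -> \bar R[i]}.

Lemma complex_nullS (A B : set (borel_circle R)) : measurable B -> B `<=` A ->
  complex_null mu A -> complex_null mu B.
Proof. by move=> mB BA [mA A0]; split => // D mD DB; apply: A0 => // x /DB /BA. Qed.

(* The support is an uncountable intersection; by second countability, rational
   balls make its complement a countable union of null sets. *)
Lemma null_cover_support_complement : exists F : (set (borel_circle R))^nat,
  (forall i, complex_null mu (F i)) /\
  ~` measure_support mu `<=` \bigcup_i F i.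
Proof.
have null0 : complex_null mu set0.
  by split => // B _; rewrite subset0 => ->; rewrite charge0.
pose Bq (c : rat * rat * nat) : set (borel_circle R) :=
  circle_ball (ratr c.1.1 +i* ratr c.1.2) (c.2.+1%:R^-1).
(* Codes of rational balls are enumerated; balls that are not null are replaced by the empty set. *)
pose F i : set (borel_circle R) := if unpickle i is Some c then
  (if `[< complex_null mu (Bq c) >] then Bq c else set0) else set0.
exists F; split.
  by move=> i; rewrite /F; case: unpickle => // c; case: asboolP.
move=> z; rewrite /measure_support => /existsNP[G] /not_implyP[[cG G0]] nGz.
have mG : measurable (~` G : set (borel_circle R)).
  by apply: circle_open_measurable; exact: closed_openC.
have nG := measure_variation_null mG G0.
have [e e0 eG] := open_circle_ball_subset (closed_openC cG) nGz.
(* With radius below [e / 2] and a center [q] closer to [z] than that radius, the ball contains [z]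
   and stays within distance [e] of it. *)
have [k ke] : exists k : nat, k.+1%:R^-1 < e / 2.
  have := near_infty_natSinv_lt (PosNum (divr_gt0 e0 (ltr0n R 2))).
  by move=> /= [k _ /(_ k)]; rewrite /= leqnn => /(_ isT) h; exists k.
have k0 : 0 < k.+1%:R^-1 :> R by rewrite invr_gt0.
have [q zq] := exists_rational_near (set_val z) k0.
exists (pickle (q, k)); [exact: I | rewrite /F pickleK].
suff BG : Bq (q, k) `<=` ~` G.
  case: asboolP => [_ //|[]]; apply: complex_nullS BG nG.
  exact: (circle_open_measurable (open_circle_ball _ _)).
apply: subset_trans eG => w; rewrite /Bq /circle_ball /= => qw.
have -> : set_val z - set_val w =
  (ratr q.1 +i* ratr q.2 - set_val w) - (ratr q.1 +i* ratr q.2 - set_val z) by ring.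
apply: (le_lt_trans (le_normcB _ _)); rewrite [e]splitr.
by apply: ltrD; [exact: lt_trans qw ke | exact: lt_trans zq ke].
Qed.

End support_complement.
End circle_topology.

(** * The estimate on low Fourier coefficients *)

Lemma kernel_ratio_itv (R : realFieldType) (delta : R) : 0 < delta < 1 ->
  0 <= 1 - (delta / 2) ^+ 2 / 4 < 1.
Proof.
move=> /andP[d0 d1]; have : 0 < (delta / 2) ^+ 2 by rewrite exprn_gt0// divr_gt0.
have : (delta / 2) ^+ 2 <= 1 ^+ 2 by rewrite lerXn2r ?nnegrE; lra.
by rewrite expr1n; lra.
Qed.

Lemma normCE (R : rcfType) (z : R[i]) : `|z| = (normc z)%:C.
Proof. by []. Qed.

(** By linearity the sum is the integral of [P_K(z / x)] against [mu]. Off countably many null sets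
    [x] lies in the support, hence at distance at least [delta / 2] from [z], where the kernel is
    small; the [8] comes from [complex_integral_le]. *)
Lemma fourier_kernel_bound (R : realType)
    (mu : {charge set (borel_circle R) -> \bar R[i]}) (z0 : circle R)
    (K : nat) (delta : R) (z : R[i]) :
  (measure_variation mu setT <= 1)%E -> 0 < delta < 1 ->
  (forall x : circle R, normc (set_val z0 - set_val x) < delta -> ~ measure_support mu x) ->
  normc z = 1 -> normc (z - set_val z0) <= delta / 2 ->
  `|\sum_(i < (2 * K).+1) binomial_weight R[i] K i * z ^ (i%:Z - K%:Z)
       * fourier_coef mu (i%:Z - K%:Z)|
    <= (8 * (1 - (delta / 2) ^+ 2 / 4) ^+ K)%:C.
Proof.
move=> mu1 delta_itv hsupp z1 zz0; have /andP[d0 d1] := delta_itv.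
have {}mu1 B : measurable B -> normc (fine (mu B)) <= 1.
  by move=> mB; exact: measure_variation_le1.
have neq0 (y : R[i]) : normc y = 1 -> y != 0.
  by apply: contra_eq_neq => ->; rewrite Normc.normc0 eq_sym oner_eq0.
have z00 := neq0 _ z1.
pose co (i : nat) : R[i] := binomial_weight R[i] K i * z ^ (i%:Z - K%:Z).
pose fi (i : nat) (x : borel_circle R) : R[i] := set_val x ^ (- (i%:Z - K%:Z)).
have mfi i : cbounded_measurable (fi i) by exact: cbounded_measurable_exprz.
have [mS SE] := complex_integral_sum mu (2 * K).+1 co mfi.
rewrite -[X in `|X|]SE normCE lecR.
have [F [F0 FU]] := null_cover_support_complement mu.
apply: (complex_integral_le mS F0).
- exact: mu1.
- by rewrite exprn_ge0//; have /andP[] := kernel_ratio_itv delta_itv.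
move=> x nFx.
have x1 := normc_set_val x; have x0 := neq0 _ x1.
have far : delta <= normc (set_val z0 - set_val x).
  rewrite leNgt; apply/negP => /hsupp nx; apply: nFx; exact: FU.
set u := z / set_val x.
have u1 : `|u| = 1.
  by rewrite normCE /u Normc.normcM Normc.normcV x1 z1 invr1 mulr1.
have u0 : u != 0 by rewrite mulf_neq0// invr_eq0.
have uf : (delta / 2)%:C <= `|1 - u|.
  have -> : 1 - u = (set_val x - z) / set_val x by rewrite /u mulrBl divff.
  rewrite normCE lecR Normc.normcM Normc.normcV x1 invr1 mulr1.
  have := le_normcB (set_val x - z) (set_val z0 - z).
  have -> : set_val x - z - (set_val z0 - z) = set_val x - set_val z0 by ring.
  rewrite normc_distC [normc (set_val z0 - z)]normc_distC.
  move=> h; have := le_trans far h; lra.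
have -> : \sum_(i < (2 * K).+1) co i * fi i x = ((1 + u) ^+ 2 / u) ^+ K / 4 ^+ K.
  rewrite -binomial_kernelE// mulr_suml; apply: eq_bigr => i _.
  rewrite /co /fi /u /binomial_weight expfzMl exprz_inv.
  ring.
rewrite -lecR -normCE normrM normfV [`|4 ^+ K|]ger0_norm ?exprn_ge0//.
rewrite ler_pdivrMr ?exprn_gt0// [leRHS]mulrC.
have d20 : 0 <= (delta / 2)%:C :> R[i] by rewrite lecR divr_ge0// ltW.
apply: (le_trans (norm_binomial_kernel K u1 d20 uf)).
have -> : ((1 - (delta / 2) ^+ 2 / 4) ^+ K)%:C = (1 - (delta / 2)%:C ^+ 2 / 4) ^+ K :> R[i].
  rewrite (rmorphXn (real_complex R)) rmorphB rmorphM (rmorphXn (real_complex R)).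
  by rewrite fmorphV rmorph_nat rmorph1.
by [].
Qed.

(** * Finite lists of exceptional and of low frequencies *)

Lemma sparse3_absz (R : realType) (L : set int) (n m : int) : sparse (3 : R) L ->
  L n -> L m -> (`|m| < `|n|)%N -> (3 * `|m| <= `|n|)%N.
Proof.
(* The case [m = 0] is set apart because its quotient is [+oo]; otherwise the quotient is a real
   number and the bound descends to integers. *)
move=> sL Ln Lm mn; have [->|m0] := eqVneq m 0; first by rewrite absz0 muln0.
have /ereal_inf_lbound h : [set ((`|nm.1|%R%:~R : R)%:E / (`|nm.2|%R%:~R : R)%:E)%E |
    nm in [set nm : int * int | [/\ L nm.1, L nm.2 & `|nm.1| > `|nm.2|]]]
    ((`|n|%R%:~R : R)%:E / (`|m|%R%:~R : R)%:E)%E.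
  by exists (n, m) => //; split => //=; lia.
have := le_trans sL h.
rewrite inver ifF; last by rewrite intr_eq0 normr_eq0; exact/negbTE.
rewrite -EFinM lee_fin ler_pdivlMr; last by rewrite ltr0z normr_gt0.
rewrite -[3 : R]/(3%:Z%:~R) -intrM ler_int; lia.
Qed.

(* A [3]-sparse set has at most one absolute value in each [[2^i, 2^(i+1))]. *)
Lemma sparse_dyadic_cover (R : realType) (L : set int) (l : nat) :
  sparse (3 : R) L -> exists S : seq int, (size S <= 2 * l)%N /\
    forall n, L n -> n != 0 -> (`|n| < 2 ^ l)%N -> n \in S.
Proof.
move=> sL; elim: l => [|l [S [sS hS]]].
  by exists [::]; split => // n _ n0; lia.
have [[m [Lm lm ml]]|none] :=
    pselect (exists m, [/\ L m, (2 ^ l <= `|m|)%N & (`|m| < 2 ^ l.+1)%N]).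
  (* An absolute value determines an integer up to sign, so each dyadic block adds at most two
     frequencies. *)
  exists [:: m, - m & S]; split=> [/=|n Ln n0 nl]; first lia.
  rewrite !inE; have [nl'|nl'] := ltnP `|n| (2 ^ l); first by rewrite hS ?orbT.
  have nm : `|n|%N = `|m|%N.
    move: nl ml; rewrite expnS => nl ml.
    case: (ltngtP `|n|%N `|m|%N) => // h.
      by have := sparse3_absz sL Lm Ln h; lia.
    by have := sparse3_absz sL Ln Lm h; lia.
  by rewrite orbA; apply/orP; left; lia.
exists S; split; first lia.
move=> n Ln n0 nl; apply: hS => //; rewrite ltnNge; apply/negP => h.
by apply: none; exists n.
Qed.

Definition low_frequencies (N : nat) : seq int :=
  [seq i%:Z - N%:Z | i <- iota 0 (2 * N + 1)].

Lemma mem_low_frequencies N (n : int) : (n \in low_frequencies N) = (`|n| <= N)%N.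
Proof.
apply/idP/idP => [/seq.mapP[j]|nN]; first by rewrite mem_iota => h ->; lia.
by apply/seq.mapP; exists `|(n + N%:Z)%R|%N; rewrite ?mem_iota; lia.
Qed.

Lemma uniq_low_frequencies N : uniq (low_frequencies N).
Proof. by rewrite map_inj_uniq ?iota_uniq// => i j /= h; lia. Qed.

(** There are [2N + 1] terms, each at most [t ^+ 2 <= t] with [t = gamma / (2N + 2)]; the
    denominator [2N + 2] makes the inequality strict. *)
Lemma low_sum_lt (R : realType) (N : nat) (gamma : R) (x : int -> R) :
  0 < gamma < 1 -> (forall n, 0 <= x n) ->
  (forall n : int, (`|n| <= N)%N -> x n <= gamma / (2 * N + 2)%:R) ->
  \sum_(n \in [set n : int | `|n| <= N%:Z]) x n ^+ 2 < gamma.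
Proof.
move=> /andP[g0 g1] x0 hx.
have -> : [set n : int | `|n| <= N%:Z] = [set` low_frequencies N].
  by apply/seteqP; split => n /=; rewrite mem_low_frequencies; lia.
rewrite -fsbig_seq ?uniq_low_frequencies//.
have D0 : 0 < (2 * N + 2)%:R :> R by rewrite ltr0n addn2.
set t := gamma / _ in hx.
have t0 : 0 < t by rewrite divr_gt0.
have tD : t * (2 * N + 2)%:R = gamma by rewrite divfK// gt_eqF.
have t1 : t <= 1.
  rewrite ler_pdivrMr// mul1r (le_trans (ltW g1))// ler1n addn2//.
apply: (@le_lt_trans _ _ (\sum_(n <- low_frequencies N) t)).
  rewrite !big_seq; apply: ler_sum => n; rewrite mem_low_frequencies => nN.
  rewrite expr2 -[leRHS]mulr1; apply: ler_pM => //; first exact: hx.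
  exact: le_trans (hx _ nN) t1.
rewrite big_const_seq count_predT size_map size_iota iter_addr_0 -mulr_natr -tD.
by rewrite ltr_pM2l// ltr_nat; lia.
Qed.

(** The witness is [c + i s] with [c = sqrt (1 - s^2)]. Its imaginary part gives the lower bound,
    and [c >= c^2 = 1 - s^2 >= 1 - s] gives the upper one. *)
Lemma exists_small_rotation (R : realType) (s : R) : 0 < s <= 1 ->
  exists w : R[i], [/\ normc w = 1, s <= normc (w - 1) & normc (w - 1) <= 2 * s].
Proof.
move=> /andP[s0 s1]; have s2 : s ^+ 2 <= 1 by rewrite expr_le1// ltW.
have c0 : 0 <= 1 - s ^+ 2 by rewrite subr_ge0.
pose c := Num.sqrt (1 - s ^+ 2).
have cc : c ^+ 2 = 1 - s ^+ 2 by rewrite sqr_sqrtr.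
have cge0 : 0 <= c by exact: sqrtr_ge0.
have c1 : c <= 1.
  by rewrite -[leRHS]sqrtr1 ler_wsqrtr// gerBl sqr_ge0.
exists (c +i* s); split.
- by rewrite /= cc subrK sqrtr1.
- have := normIm_le (c +i* s - 1) => /=.
  by rewrite subr0 gtr0_norm.
- apply: (le_trans (normc_le_ReIm _)) => /=.
  rewrite subr0 [`|s|]gtr0_norm// ler0_norm ?subr_le0//.
  have : s ^+ 2 <= s by rewrite expr2 ler_piMr// ltW.
  have : c ^+ 2 <= c by rewrite expr2 ler_piMr.
  by rewrite cc; lra.
Qed.

(** * Small low coefficients from a gap in the support *)

Section dense_support.
Context (R : realType) (mu : {charge set (borel_circle R) -> \bar R[i]}).
Context (delta eps : R) (z0 : circle R) (L : set int) (N l : nat).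
Hypothesis delta_itv : 0 < delta < 1.
Hypothesis mu1 : (measure_variation mu setT <= 1)%E.
Hypothesis gap : forall x : circle R,
  normc (set_val z0 - set_val x) < delta -> ~ measure_support mu x.
Hypothesis eps0 : 0 <= eps.
Hypothesis sparseL : sparse (3 : R) L.
Hypothesis small : forall n : int, `|n| > N%:Z -> ~ L n ->
  normc (fourier_coef mu n) <= eps.
Hypothesis Nl : (N + 2 <= l)%N.

Lemma low_fourier_bound (k : int) : (`|k| <= N)%N ->
  normc (fourier_coef mu k) <=
  (64 * 2 ^+ l / delta) ^+ (2 * N + 2 * l + 3) * (2 * 2 ^+ l * 3 ^+ N)
    * (8 * (1 - (delta / 2) ^+ 2 / 4) ^+ (2 ^ l) + eps).
Proof.
move=> kN; have /andP[d0 d1] := delta_itv.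
pose K := (2 ^ l)%N.
have lK : (l < K)%N by exact: ltn_expl.
have NK : (2 * N <= K)%N.
  have : (2 ^ N.+1 <= K)%N by rewrite leq_exp2l//; lia.
  by rewrite expnS; have := ltn_expl N (isT : (1 < 2)%N); lia.
have K0 : (0 < K)%N by lia.
have KR : 0 < K%:R :> R by rewrite ltr0n.
have KE : K%:R = 2 ^+ l :> R by rewrite natrX.
(* The cover is taken up to [2 ^ l.+1] so as to include the end frequencies [K] and [- K]. Together
   with the [2N + 1] low frequencies it has at most [2N + 2l + 3] entries. *)
have [S' [sS' hS']] := sparse_dyadic_cover l.+1 sparseL.
pose S := low_frequencies N ++ S'.
have sS : (size S <= 2 * N + 2 * l + 3)%N.
  by rewrite size_cat size_map size_iota; lia.
have nK : (2 * N + 2 * l + 3 <= 4 * K)%N.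
  by move: lK NK; rewrite /K; lia.
(* With [|w - 1| <= 2 s = delta / (8 K)], the at most [4 K] rotation steps stay within [delta / 2]
   of [z0], and [2 K |w - 1| <= delta / 4] is below [1/2]. *)
pose s : R := delta / (16 * K%:R).
have K16 : 0 < 16 * K%:R :> R by rewrite mulr_gt0.
have s0 : 0 < s by rewrite divr_gt0.
have sK : s * (16 * K%:R) = delta by rewrite divfK// gt_eqF.
have K1 : 1 <= K%:R :> R by rewrite ler1n.
have s1 : s <= 1 by rewrite ler_pdivrMr//; lra.
have [w [w1 ws sw]] : exists w : R[i],
    [/\ normc w = 1, s <= normc (w - 1) & normc (w - 1) <= 2 * s].
  by apply: exists_small_rotation; rewrite s0.
have normw : `|w| = 1 by rewrite normCE w1.
have normz0 : `|set_val z0| = 1 by rewrite normCE normc_set_val.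
have natC n : (n%:R : R)%:C = n%:R :> R[i] by rewrite rmorph_nat.
have wK : (2 * K)%:R * `|w - 1| <= 2^-1.
  have -> : 2^-1 = (2^-1 : R)%:C :> R[i] by rewrite fmorphV rmorph_nat.
  rewrite normCE -natC -rmorphM lecR natrM.
  have : 2 * K%:R * normc (w - 1) <= 2 * K%:R * (2 * s) by rewrite ler_wpM2l// ltW// mulr_gt0.
  have -> : 2 * K%:R * (2 * s) = delta / 4 by rewrite -sK; field.
  lra.
have aS (n : int) : n \notin S -> (`|n| <= K)%N -> (N < `|n|)%N ->
    `|fourier_coef mu n| <= eps%:C.
  rewrite mem_cat negb_or => /andP[_ nS'] nK' Nn; rewrite normCE lecR.
  apply: small; first by clear -Nn; lia.
  move=> Ln; move/negP: nS'; apply; apply: hS' => //; first by apply/eqP; clear -Nn; lia.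
  by rewrite expnS -/K; clear -K0 nK'; lia.
have SN (n : int) : (`|n| <= N)%N -> n \in S by rewrite mem_cat mem_low_frequencies => ->.
have epsC : 0 <= eps%:C :> R[i] by rewrite lecR.
have hB j : (j <= size S)%N ->
  `|\sum_(i < (2 * K).+1) binomial_weight R[i] K i *
      (set_val z0 * w ^+ j) ^ (i%:Z - K%:Z) * fourier_coef mu (i%:Z - K%:Z)|
    <= (8 * (1 - (delta / 2) ^+ 2 / 4) ^+ K)%:C.
  move=> jS; apply: (fourier_kernel_bound K mu1 delta_itv gap).
    by apply: complexI; rewrite -normCE normrM normrX normw normz0 expr1n mulr1.
  rewrite -lecR -normCE.
  have -> : set_val z0 * w ^+ j - set_val z0 = set_val z0 * (w ^+ j - 1) by ring.
  rewrite normrM normz0 mul1r; apply: (le_trans (norm_expB1_le j normw)).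
  rewrite normCE -natC -rmorphM lecR.
  have jK : j%:R <= 4 * K%:R :> R by rewrite -natrM ler_nat; clear -jS sS nK; lia.
  apply: (@le_trans _ _ (4 * K%:R * (2 * s))); first by apply: ler_pM => //; exact: normc_ge0.
  by rewrite -sK; lra.
rewrite -/K; move: hB; set B : R := 8 * _.
have : 0 <= B.
  by rewrite mulr_ge0// exprn_ge0//; have /andP[] := kernel_ratio_itv delta_itv.
move: B => B B0 hB.
have := low_coef_bound K0 NK epsC normw normz0 wK aS SN hB kN; rewrite !normCE.
have -> : (2^-1 * (normc (w - 1))%:C) ^+ size S = ((2^-1 * normc (w - 1)) ^+ size S)%:C.
  by rewrite (rmorphXn (real_complex R)) rmorphM fmorphV rmorph_nat.
have -> : 2 ^+ size S * (2 * K%:R * 3 ^+ N) * (B%:C + eps%:C) =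
    (2 ^+ size S * (2 * K%:R * 3 ^+ N) * (B + eps))%:C.
  rewrite !rmorphM (rmorphD (real_complex R) B eps) !(rmorphXn (real_complex R)).
  by rewrite !rmorph_nat.
rewrite -rmorphM lecR => main.
have s20 : 0 < s / 2 by rewrite divr_gt0.
have step : normc (fourier_coef mu k) * (s / 2) ^+ size S <=
    2 ^+ size S * (2 * K%:R * 3 ^+ N) * (B + eps).
  apply: le_trans main; rewrite ler_wpM2l ?normc_ge0//.
  have hs : s / 2 <= 2^-1 * normc (w - 1) by rewrite mulrC ler_pM2l.
  by rewrite lerXn2r// nnegrE; [exact: ltW | exact: le_trans (ltW s20) hs].
rewrite -ler_pdivlMr ?exprn_gt0// in step.
apply: (le_trans step).
(* Doubling at each elimination and dividing by the separation [s / 2] amount to one factor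
   [2 / (s / 2) = 64 K / delta] per frequency. *)
have -> : 2 ^+ size S * (2 * K%:R * 3 ^+ N) * (B + eps) / (s / 2) ^+ size S =
    (64 * 2 ^+ l / delta) ^+ size S * ((2 * 2 ^+ l * 3 ^+ N) * (B + eps)).
  rewrite -KE; have -> : 64 * K%:R / delta = 2 / (s / 2).
    by rewrite -{1}sK; field; rewrite !gt_eqF.
  by rewrite [(2 / (s / 2)) ^+ _]expr_div_n; ring.
rewrite -[leRHS]mulrA ler_wpM2r ?mulr_ge0 ?addr_ge0 ?exprn_ge0//.
(* The base is at least [1], so the exponent [size S] may be raised to its upper bound. *)
rewrite ler_weXn2l// ler_pdivlMr// mul1r -KE; lra.
Qed.

End dense_support.

Theorem proposition2p3 (R : realType) (N : nat) (gamma delta : R)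
    (N_ge1 : (1 <= N)%N)
    (gamma_itv : 0 < gamma < 1) (delta_itv : 0 < delta < 1) :
  exists eps : R, 0 < eps /\
    forall mu : {charge set (borel_circle R) -> \bar R[i]},
      (measure_variation mu setT <= 1)%E ->
      \sum_(n \in [set n : int | `|n| <= N%:Z])
        normc (fourier_coef mu n) ^+ 2 >= gamma ->
      (exists L : set int, sparse (3 : R) L /\
        forall n : int, `|n| > N%:Z -> ~ L n ->
          normc (fourier_coef mu n) <= eps) ->
      (ereal_sup [set circle_dist z (measure_support mu) | z in setT]
        <= delta%:E)%E.
Proof.
have /andP[d0 d1] := delta_itv; have /andP[g0 g1] := gamma_itv.
(* [alpha] is the size of coefficient that [low_sum_lt] tolerates; one half is spent on the kernel
   term and the other on [eps]. *)
pose alpha := gamma / (2 * N + 2)%:R.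
have a0 : 0 < alpha by rewrite divr_gt0// ltr0n addn2.
have a20 : 0 < alpha / 2 by rewrite divr_gt0.
pose rho := 1 - (delta / 2) ^+ 2 / 4.
have rho01 : 0 <= rho < 1 by exact: kernel_ratio_itv.
have [l [Nl hl]] := exponential_beats_power_log N d0 rho01 a20.
set A := _ * (2 * _ * _) in hl.
have A0 : 0 < A by rewrite !mulr_gt0 ?exprn_gt0 ?divr_gt0 ?mulr_gt0 ?exprn_gt0.
(* [A] depends only on [N], [gamma] and [delta], and [A * eps] is exactly [alpha / 2]. *)
exists (alpha / 2 / A); split; first by rewrite divr_gt0.
move=> mu mu1 low [L [sL small]].
apply: ub_ereal_sup => _ [z0 _ <-]; rewrite leNgt; apply/negP => far.
(* A support point closer than [delta] would bound the infimum defining the distance. An empty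
   support, at distance [+oo], satisfies the claim vacuously. *)
have gap (x : circle R) :
    normc (set_val z0 - set_val x) < delta -> ~ measure_support mu x.
  move=> xz sx; move: far; rewrite ltNge => /negP; apply.
  apply: (le_trans (ereal_inf_lbound _)); first by exists x.
  by rewrite lee_fin ltW.
have e0 : 0 <= alpha / 2 / A by rewrite ltW// divr_gt0.
have bound k := low_fourier_bound delta_itv mu1 gap e0 sL small Nl (k := k).
move: low; rewrite leNgt => /negP; apply.
apply: low_sum_lt => // [n|n nN]; first exact: normc_ge0.
apply: (le_trans (bound _ nN)); rewrite -/rho -/A -/alpha mulrDr.
rewrite [A * (_ / A)]mulrC divfK ?gt_eqF// [leRHS]splitr lerD2r; exact: ltW.
Qed.
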